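(* Let $F$ be the distribution function of a nonnegative real random variable. For every natural number $k\geq 1$, $$C(F)=C(F^{*k}),$$ where, for a distribution function $G$ with tail $\overline{G}=1-G$, $$C(G):=\sup\left\{t\in\mathbb{R}_{\geq 0}:\lim_{x\to+\infty}\overline{G}(x)e^{xt}=0\right\}.$$
   Context: For a distribution function $F$ (of a discrete or continuous random variable), $\overline{F}=1-F$ denotes its tail. $F^{*k}$ denotes the $k$-fold convolution of $F$ with itself, i.e. the distribution function of the sum of $k$ independent random variables each with distribution $F$ (so $F^{*1}=F$). The supremum defining $C$ is taken in $[0,+\infty]$. *)

(* Defs.v *)
(* MathComp-Analysis. *)
From HB Require Import structures.
From mathcomp Require Import all_boot all_order all_algebra.
From mathcomp Require Import all_classical all_reals all_analysis.

Set Implicit Arguments.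
Unset Strict Implicit.
Unset Printing Implicit Defensive.

Import Order.TTheory GRing.Theory Num.Theory.
Import numFieldTopology.Exports numFieldNormedType.Exports.

Local Open Scope classical_set_scope.
Local Open Scope ring_scope.
Local Open Scope ereal_scope.

Section convolution.
Context {R : realType}.

Definition sum2 (p : R * R) : R := (p.1 + p.2)%R.

Lemma measurable_sum2 : measurable_fun [set: R * R] sum2.
Proof.
by apply: measurable_realfun.measurable_funD;
  [exact: measurable_fst|exact: measurable_snd].
Qed.

HB.instance Definition _ := isMeasurableFun.Build _ _ _ _ sum2 measurable_sum2.

(* The law of the sum of two independent random variables with laws mu and
   nu, realised as the coordinates of the product space. *)
Definition convolution (mu nu : probability R R) : probability R R :=
  distribution (mu \x nu) sum2.

(* The law of the sum of k independent random variables with law mu; the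
   empty sum (k = 0) has law the Dirac mass at 0. *)
Definition convolution_power (mu : probability R R) (k : nat) :
    probability R R :=
  iterop k convolution mu \d_(0%R : R).

Lemma convolution_power1 (mu : probability R R) : convolution_power mu 1 = mu.
Proof. by []. Qed.

Lemma convolution_powerS (mu : probability R R) (k : nat) :
  convolution_power mu k.+2 = convolution mu (convolution_power mu k.+1).
Proof. by []. Qed.

Definition df (mu : probability R R) (x : R) : \bar R := mu `]-oo, x]%classic.

Lemma cdf_df d (T : measurableType d) (P : probability T R)
  (X : {RV P >-> R}) : cdf X = df (distribution P X).
Proof. by []. Qed.

Definition tail (G : R -> \bar R) (x : R) : \bar R := 1 - G x.

Definition C (G : R -> \bar R) : \bar R :=
  ereal_sup [set t%:E | t in [set t : R | (0 <= t)%R /\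
    tail G x * (expR (x * t))%:E @[x --> +oo%R] --> 0]].

End convolution.

(* Main.v *)
(* For laws mu and nu on [0, +oo[ one has C(mu * nu) = min(C(mu), C(nu)), and
   the theorem follows by induction on k. The tail of mu * nu dominates both
   tails, which gives one inequality. Conversely, if both tails are O(e^(-tx)),
   then covering {a + b > x} by n + 1 rectangles of mesh x / n bounds the tail
   of mu * nu by O(e^(-t(1 - 2/n)x)), and n is arbitrary. *)
Require Import Defs.
From HB Require Import structures.
From mathcomp Require Import all_boot all_order all_algebra.
From mathcomp Require Import all_classical all_reals all_analysis.
From mathcomp Require Import ring lra.

Import Order.TTheory GRing.Theory Num.Theory.
Import numFieldTopology.Exports numFieldNormedType.Exports.

Local Open Scope classical_set_scope.
Local Open Scope ring_scope.
Local Open Scope ereal_scope.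

(** * Tails of laws and their exponential decay *)

Lemma tail_df (R : realType) (mu : probability R R) (x : R) :
  tail (df mu) x = mu `]x, +oo[%classic.
Proof. by rewrite /tail /df -probability_setC// setCitvl. Qed.

Lemma tail_df_cvg0 (R : realType) (mu : probability R R) :
  tail (df mu) x @[x --> +oo%R] --> 0.
Proof.
(* [cvg_ccdfy0] speaks of random variables; under [mu] the identity is one, with law [mu]. *)
pose id_RV : {RV mu >-> R} := HB.pack (idfun : R -> R)
  (isMeasurableFun.Build _ _ _ _ _ (@measurable_id _ R setT)).
have := cvg_ccdfy0 id_RV.
by under eq_fun do rewrite tail_df.
Qed.

(** The rate 0 is always admissible, so the supremum is never [-oo]. *)
Lemma C_ge0 (R : realType) (mu : probability R R) : 0 <= C (df mu).
Proof.
apply: ereal_sup_ubound; exists 0%R => //; split => //.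
under eq_fun do rewrite mulr0 expR0 mule1.
exact: tail_df_cvg0.
Qed.

Lemma C_le_tail (R : realType) (mu nu : probability R R) :
  (forall x, tail (df mu) x <= tail (df nu) x) -> C (df nu) <= C (df mu).
Proof.
move=> le_tail; apply: le_ereal_sup => _ [t [t0 nut]] <-; exists t => //.
split => //; apply: (squeeze_cvge _ (cvg_cst 0) nut).
near=> x; rewrite tail_df mule_ge0 ?lee_fin ?expR_ge0//= -tail_df.
by rewrite lee_wpmul2r// lee_fin expR_ge0.
Unshelve. all: by end_near. Qed.

(** Far out the limit gives the bound; elsewhere the tail is at most 1 and the constant absorbs it.
    All real [x] are covered because the rectangles used later may start at negative abscissas, and
    the freedom [s <= t] lets two laws share one rate. *)
Lemma tail_exp_bound (R : realType) (mu : probability R R) (s t : R) :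
  (0 <= s <= t)%R -> tail (df mu) x * (expR (x * t))%:E @[x --> +oo%R] --> 0 ->
  exists2 K : R, (0 <= K)%R &
    forall x, tail (df mu) x <= (K * expR (- (s * x)))%:E.
Proof.
move=> /andP[s0 st] mut.
have [M [_ tailM]] : \forall x \near +oo%R,
    tail (df mu) x * (expR (x * t))%:E < 1.
  apply: (mut [set y | y < 1]); apply: open_nbhs_nbhs; split => //=.
  exact: open_ereal_lt_ereal.
(* Beyond [N] both [x] and [s * N] are nonnegative, so [s * x - s * N <= t * x]. *)
pose N := Num.max M 0%R.
exists (expR (s * N)); first exact: expR_ge0.
move=> x; rewrite -expRD; have [xN|Nx] := leP x N.
  rewrite tail_df (le_trans (probability_le1 _ _))// lee_fin -[leLHS]expR0.
  by rewrite ler_expR -mulrBr mulr_ge0// subr_ge0.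
have [Mx x0] : (M < x)%R /\ (0 < x)%R.
  by move: Nx; rewrite gt_max => /andP.
move/ltW: (tailM x Mx) => {}tailM.
apply: (@le_trans _ _ (expR (- (x * t)))%:E).
  rewrite -[leLHS]mule1 -[X in _ * X%:E](expR0) -(subrr (x * t)%R) expRD EFinM.
  by rewrite muleA -[leRHS]mul1e lee_wpmul2r// lee_fin expR_ge0.
rewrite lee_fin ler_expR.
have N0 : (0 <= N)%R by rewrite le_max lexx orbT.
nra.
Qed.

Lemma cvg_expRNM (R : realType) (c : R) : (0 < c)%R ->
  expR (- (c * x)) @[x --> +oo%R] --> (0 : R)%R.
Proof.
move=> c0.
have cy : (c * x)%R @[x --> +oo%R] --> +oo%R.
  by apply: gt0_cvgMry => //; exact: cvg_id.
exact: (cvg_comp _ _ cy (@cvgr_expR R)).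
Qed.

(** The strict gap leaves a factor [expR (- ((t - s) * x))], which tends to 0. *)
Lemma tail_exp_cvg0 (R : realType) (mu : probability R R) (K s t : R) :
  (s < t)%R ->
  (\forall x \near +oo%R, tail (df mu) x <= (K * expR (- (t * x)))%:E) ->
  tail (df mu) x * (expR (x * s))%:E @[x --> +oo%R] --> 0.
Proof.
move=> st bnd.
have lim0 : (K * expR (- ((t - s) * x)))%:E @[x --> +oo%R] --> 0.
  apply: cvg_EFin; first by near=> x.
  rewrite -[X in _ --> X](mulr0 K); apply: cvgMr.
  by apply: cvg_expRNM; rewrite subr_gt0.
apply: (squeeze_cvge _ (cvg_cst 0) lim0).
near=> x; rewrite tail_df mule_ge0 ?lee_fin ?expR_ge0//= -tail_df.
have -> : (- ((t - s) * x) = - (t * x) + x * s)%R by ring.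
rewrite expRD mulrA [leRHS]EFinM lee_wpmul2r ?lee_fin ?expR_ge0//.
by near: x.
Unshelve. all: by end_near. Qed.

(* The factors are probabilities here, whereas [product_measure1E] states its
   right-hand side with coercions that probability lemmas do not match. *)
Lemma product_probability1E (R : realType) (mu nu : probability R R)
    (A B : set R) : measurable A -> measurable B ->
  (mu \x nu) (A `*` B) = mu A * nu B.
Proof. exact: product_measure1E. Qed.

(** * Lower and upper bounds on the tail of a convolution *)

Lemma tail_convolution (R : realType) (mu nu : probability R R) (x : R) :
  tail (df (convolution mu nu)) x =
  (mu \x nu) [set p | (x < p.1 + p.2)%R].
Proof.
rewrite tail_df /convolution /distribution/= /pushforward/=; congr (_ _).
by apply/seteqP; split=> p /=; rewrite in_itv/= andbT.
Qed.

Lemma measurable_sum_gt (R : realType) (x : R) :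
  measurable [set p : R * R | (x < p.1 + p.2)%R].
Proof.
rewrite (_ : mkset _ = setT `&` @sum2 R @^-1` `]x, +oo[).
  exact: measurable_sum2.
by apply/seteqP; split=> p /=; rewrite in_itv/= andbT// => -[].
Qed.

(** Adding a nonnegative term keeps a sum above [x]: the rectangle []x, +oo[ * [0, +oo[] lies in the
    half-plane. *)
Lemma tail_le_convolutionl (R : realType) (mu nu : probability R R) (x : R) :
  nu `[0%R, +oo[%classic = 1 -> tail (df mu) x <= tail (df (convolution mu nu)) x.
Proof.
move=> nu1; rewrite tail_convolution tail_df.
rewrite -[leLHS]mule1 -nu1 -product_probability1E//.
apply: le_measure; rewrite ?inE; [exact: measurableX|exact: measurable_sum_gt|].
by move=> p [] /=; rewrite !in_itv/= !andbT => ? ?; lra.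
Qed.

Lemma tail_le_convolutionr (R : realType) (mu nu : probability R R) (x : R) :
  mu `[0%R, +oo[%classic = 1 -> tail (df nu) x <= tail (df (convolution mu nu)) x.
Proof.
move=> mu1; rewrite tail_convolution tail_df.
rewrite -[leLHS]mul1e -mu1 -product_probability1E//.
apply: le_measure; rewrite ?inE; [exact: measurableX|exact: measurable_sum_gt|].
by move=> p [] /=; rewrite !in_itv/= !andbT => ? ?; lra.
Qed.

Lemma convolution_ge0 (R : realType) (mu nu : probability R R) :
  mu `[0%R, +oo[%classic = 1 -> nu `[0%R, +oo[%classic = 1 ->
  convolution mu nu `[0%R, +oo[%classic = 1.
Proof.
move=> mu1 nu1; apply/eqP; rewrite eq_le probability_le1//=.
rewrite -[leLHS]mule1 -{1}mu1 -nu1 -product_probability1E//.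
apply: le_measure; rewrite ?inE; [exact: measurableX| |].
- by rewrite -[X in measurable X]setTI; exact: measurable_sum2.
- by move=> p [] /=; rewrite !in_itv/= !andbT /sum2 => ? ?; lra.
Qed.

(* On the triangle [0 < a, b <= x < a + b], taking [i] to be the integer part
   of [a / h] gives [i * h <= a < (i + 1) * h], whence [b > (n - i - 1) * h]. *)
Lemma sum_gt_cover (R : realType) (n : nat) (h : R) : (0 < h)%R ->
  [set p : R * R | (n%:R * h < p.1 + p.2)%R] `<=`
  `](n%:R * h)%R, +oo[ `*` setT `|` setT `*` `](n%:R * h)%R, +oo[ `|`
  \big[setU/set0]_(i < n.+1)
    (`]((i%:R - 1) * h)%R, +oo[ `*` `]((n%:R - i%:R - 1) * h)%R, +oo[).
Proof.
move=> h0 [a b] /= xab.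
have [ax|xa] := ltP (n%:R * h)%R a.
  by left; left; split => //=; rewrite in_itv/= ax.
have [bx|xb] := ltP (n%:R * h)%R b.
  by left; right; split => //=; rewrite in_itv/= bx.
right; have a0 : (0 <= a / h)%R by rewrite divr_ge0//; lra.
have /andP[] := truncn_itv a0; set i := Num.trunc _ => ia ai.
have ein : (i < n.+1)%N.
  rewrite ltnS -(ler_nat R) (le_trans ia)// ler_pdivrMr//.
move: ia ai; rewrite ler_pdivlMr// ltr_pdivrMr// -natr1 => ia ai.
rewrite -(bigcup_mkord _ (fun i : nat =>
  `]((i%:R - 1) * h)%R, +oo[ `*` `]((n%:R - i%:R - 1) * h)%R, +oo[)).
exists i => //; split => /=; rewrite in_itv/= andbT; nra.
Qed.

(** Union bound over the cover [sum_gt_cover]: the two slabs give single tails, and each rectangle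
    gives a product of tails. *)
Lemma tail_convolution_bound (R : realType) (mu nu : probability R R)
    (n : nat) (h K L t : R) : (0 < h)%R -> (0 <= K)%R -> (0 <= L)%R ->
  (forall x, tail (df mu) x <= (K * expR (- (t * x)))%:E) ->
  (forall x, tail (df nu) x <= (L * expR (- (t * x)))%:E) ->
  tail (df (convolution mu nu)) (n%:R * h) <=
  (K * expR (- (t * (n%:R * h))) + L * expR (- (t * (n%:R * h))) +
   n.+1%:R * (K * L * expR (- (t * ((n%:R - 2) * h)))))%:E.
Proof.
move=> h0 K0 L0 muK nuL; rewrite tail_convolution.
have mU : measurable (\big[setU/set0]_(i < n.+1)
    (`]((i%:R - 1) * h)%R, +oo[ `*` `]((n%:R - i%:R - 1) * h)%R, +oo[)).
  by apply: bigsetU_measurable => i _; exact: measurableX.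
have mT1 : measurable (`](n%:R * h)%R, +oo[ `*` [set: R]) by exact: measurableX.
have mT2 : measurable ([set: R] `*` `](n%:R * h)%R, +oo[) by exact: measurableX.
apply: le_trans.
  apply: (le_measure (mu \x nu) _ _ (sum_gt_cover _ n h h0)); rewrite inE.
    exact: measurable_sum_gt.
  by apply: measurableU => //; exact: measurableU.
apply: (le_trans (measureU2 _ _ _)) => //; first exact: measurableU.
rewrite EFinD leeD//.
  apply: (le_trans (measureU2 _ _ _)) => //.
  rewrite EFinD leeD//.
  - by rewrite [leLHS]product_probability1E// probability_setT mule1 -tail_df.
  - by rewrite [leLHS]product_probability1E// probability_setT mul1e -tail_df.
apply: le_trans.
  apply: (Boole_inequality (mu \x nu) (A := fun i : nat =>
    `]((i%:R - 1) * h)%R, +oo[ `*` `]((n%:R - i%:R - 1) * h)%R, +oo[)).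
  by move=> i _; exact: measurableX.
have -> (c : R) : (n.+1%:R * c)%:E = \sum_(i < n.+1) c%:E.
  by rewrite sumEFin sumr_const card_ord mulr_natl.
apply: lee_sum => i _; rewrite [leLHS]product_probability1E// -!tail_df.
apply: (@le_trans _ _ ((K * expR (- (t * ((i%:R - 1) * h))))%:E *
                       (L * expR (- (t * ((n%:R - i%:R - 1) * h))))%:E)).
  by apply: lee_pmul => //; rewrite tail_df.
(* The abscissas [(i - 1) * h] and [(n - i - 1) * h] add up to [(n - 2) * h], whatever [i] is. *)
rewrite -EFinM lee_fin mulrACA -expRD le_eqVlt; apply/orP; left; apply/eqP.
by congr (_ * expR _)%R; ring.
Qed.

Lemma tail_convolution_decay (R : realType) (mu nu : probability R R)
    (K L s t : R) : (0 <= s < t)%R -> (0 <= K)%R -> (0 <= L)%R ->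
  (forall x, tail (df mu) x <= (K * expR (- (t * x)))%:E) ->
  (forall x, tail (df nu) x <= (L * expR (- (t * x)))%:E) ->
  tail (df (convolution mu nu)) x * (expR (x * s))%:E @[x --> +oo%R] --> 0.
Proof.
move=> /andP[s0 st] K0 L0 muK nuL.
(* With mesh [x / n.+1] the rate drops from [t] to [t * (1 - 2 / n.+1)]; this choice of [n] keeps it
   above [s]. *)
have [n nst] : exists n : nat, (2 * t < (t - s) * n.+1%:R)%R.
  exists (Num.trunc (2 * t / (t - s)))%R.
  by rewrite -ltr_pdivrMl ?subr_gt0// mulrC truncnS_gt.
have n0 : (0 < n.+1%:R :> R)%R by rewrite ltr0Sn.
pose r := (t * (1 - 2 / n.+1%:R))%R.
have sr : (s < r)%R.
  rewrite -subr_gt0 /r (_ : _ - _ = ((t - s) * n.+1%:R - 2 * t) / n.+1%:R)%R.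
    by rewrite divr_gt0// subr_gt0.
  by field; rewrite gt_eqF.
apply: (@tail_exp_cvg0 _ _ (K + L + n.+2%:R * (K * L))%R s r) => //.
near=> x.
have x0 : (0 < x)%R by near: x; exact: nbhs_pinfty_gt.
have h0 : (0 < x / n.+1%:R)%R by rewrite divr_gt0.
have := tail_convolution_bound _ mu nu n.+1 _ _ _ _ h0 K0 L0 muK nuL.
have -> : (n.+1%:R * (x / n.+1%:R) = x)%R by field; rewrite gt_eqF.
have -> : (t * ((n.+1%:R - 2) * (x / n.+1%:R)) = r * x)%R.
  by rewrite /r; field; rewrite gt_eqF.
move=> /le_trans; apply; rewrite lee_fin.
(* The slab terms decay at the faster rate [t], so rate [r] serves for all terms. *)
have le_exp : (expR (- (t * x)) <= expR (- (r * x)))%R.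
  rewrite ler_expR lerN2 ler_wpM2r ?(ltW x0)// /r ler_piMr//; first lra.
set e := expR (- (r * x)).
have -> : ((K + L + n.+2%:R * (K * L)) * e =
           K * e + L * e + n.+2%:R * (K * L * e))%R by ring.
by rewrite lerD2r lerD// ler_wpM2l.
Unshelve. all: by end_near. Qed.

(** * The critical exponent of a convolution and of convolution powers *)

Lemma C_convolution (R : realType) (mu nu : probability R R) :
  mu `[0%R, +oo[%classic = 1 -> nu `[0%R, +oo[%classic = 1 ->
  C (df (convolution mu nu)) = Order.min (C (df mu)) (C (df nu)).
Proof.
move=> mu1 nu1; apply/eqP; rewrite eq_le; apply/andP; split.
  rewrite le_min; apply/andP; split; apply: C_le_tail => x.
    exact: tail_le_convolutionl.
  exact: tail_le_convolutionr.
(* By contradiction: each factor then has an admissible rate above the exponent of the convolution,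
   and the smaller of the two serves both. *)
rewrite leNgt; apply/negP; rewrite lt_min => /andP[].
move=> /ereal_sup_gt[_ [t1 [t10 mut1]] <-] lt1.
move=> /ereal_sup_gt[_ [t2 [t20 nut2]] <-] lt2.
pose t := Num.min t1 t2.
have t0 : (0 <= t)%R by rewrite le_min t10.
have [K K0 muK] : exists2 K : R, (0 <= K)%R &
    forall x, tail (df mu) x <= (K * expR (- (t * x)))%:E.
  by apply: tail_exp_bound mut1; rewrite t0 ge_min lexx.
have [L L0 nuL] : exists2 L : R, (0 <= L)%R &
    forall x, tail (df nu) x <= (L * expR (- (t * x)))%:E.
  by apply: tail_exp_bound nut2; rewrite t0 ge_min lexx orbT.
have lt : C (df (convolution mu nu)) < t%:E.
  by rewrite /t; case: (leP t1 t2).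
have := C_ge0 _ (convolution mu nu).
have := @ereal_sup_ubound R [set t%:E | t in [set t : R | (0 <= t)%R /\
  tail (df (convolution mu nu)) x * (expR (x * t))%:E @[x --> +oo%R] --> 0]].
(* Lying between 0 and [t], the exponent is a real number [c]. *)
rewrite -/(C _); case: (C _) lt => // c; rewrite lte_fin => ct ub.
rewrite lee_fin => c0.
(* The decay of the convolution holds only at rates strictly below [t]; the midpoint is such a rate
   and still exceeds [c]. *)
have : ((c + t) / 2)%:E <= c%:E.
  apply: ub; exists ((c + t) / 2)%R => //; split; first by lra.
  by apply: tail_convolution_decay muK nuL => //; lra.
by rewrite lee_fin; lra.
Qed.

Theorem theorem7 (R : realType) (d : measure_display) (T : measurableType d)
  (P : probability T R) (X : {RV P >-> R}) (X_ge0 : forall w : T, (0 <= X w)%R)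
  (k : nat) (k_ge1 : (1 <= k)%N) :
  C (cdf X) = C (df (convolution_power (distribution P X) k)).
Proof.
rewrite cdf_df; set mu := distribution P X.
have mu1 : mu `[0%R, +oo[%classic = 1.
  rewrite -(probability_setT P) /mu /= /distribution /pushforward.
  by congr (P _); apply/seteqP; split => w //= _; rewrite in_itv/= X_ge0.
case: k k_ge1 => // k _.
(* The induction also carries nonnegativity, which [C_convolution] asks of both factors. *)
suff [] : convolution_power mu k.+1 `[0%R, +oo[%classic = 1 /\
    C (df (convolution_power mu k.+1)) = C (df mu) by [].
elim: k => [|k [IH1 IHC]]; first by rewrite convolution_power1.
rewrite convolution_powerS; split; first exact: convolution_ge0.
by rewrite C_convolution// IHC minxx.
Qed.
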